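(* Let $C\subset\mathbb{R}^n$ be a closed cone, let $K\subset C$ be nonempty, closed and unbounded, and let $f:C\to\mathbb{R}$ be continuous on $C$ and weakly homogeneous of degree $\alpha>1$ relative to $K$. For $u\in\mathbb{R}^n$ put $f_u(x):=f(x)+\langle u,x\rangle$, and let $\mathcal{S}:\mathbb{R}^n\rightrightarrows\mathbb{R}^n$ be the solution map $\mathcal{S}(u)=\operatorname{Sol}(K,f_u)$. Assume that $f$ is bounded from below on $K$. Then $\mathcal{S}$ is upper semicontinuous on $\operatorname{int}(\mathcal{K}(K,f)^* )$.
   Context: A cone is a nonempty set closed under multiplication by positive scalars. For a nonempty closed set $S\subset\mathbb{R}^n$, the asymptotic cone is $S^{\infty}=\{v\in\mathbb{R}^n:\exists t_k\to+\infty,\ \exists x^k\in S,\ \lim_{k\to\infty} x^k/t_k=v\}$. The dual cone of a cone $D$ is $D^*=\{u\in\mathbb{R}^n:\langle u,v\rangle\ge 0\ \forall v\in D\}$; $\operatorname{int}$ denotes topological interior. $f$ is weakly homogeneous of degree $\alpha>0$ relative to $K$ if there is a continuous function $h:C\to\mathbb{R}$, positively homogeneous of degree $\alpha$ (that is, $h(tx)=t^{\alpha}h(x)$ for all $x\in C$, $t>0$), such that $f(x)-h(x)=o(\|x\|^{\alpha})$ on $K$ (i.e. $(f(x)-h(x))/\|x\|^{\alpha}\to 0$ as $\|x\|\to\infty$ with $x\in K$). Any such $h$ is called an asymptotically homogeneous function of $f$ relative to $K$ and is denoted $f^{\infty}$; all such $h$ have the same values on $K^{\infty}$, so the kernel below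 does not depend on the choice. For a nonempty closed set $S$ and a continuous function $g$ on $S$, $\operatorname{Sol}(S,g)$ is the (possibly empty) set of global minimizers of $g$ over $S$. The kernel is $\mathcal{K}(K,f):=\operatorname{Sol}(K^{\infty},f^{\infty})$; it is a closed cone whenever it is nonempty (which is the case when $f$ is bounded from below on $K$). A set-valued map $\Phi:\mathbb{R}^m\rightrightarrows\mathbb{R}^n$ is upper semicontinuous at $x$ if for every open $V\subset\mathbb{R}^n$ with $\Phi(x)\subset V$ there is a neighborhood $U$ of $x$ such that $\Phi(x')\subset V$ for all $x'\in U$; it is upper semicontinuous on $T\subset\mathbb{R}^m$ if it is so at every $x\in T$. *)

(* Defs.v *)
From HB Require Import structures.
From mathcomp Require Import all_boot all_order all_algebra.
From mathcomp Require Import all_classical all_reals all_analysis.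
Set Implicit Arguments.
Unset Strict Implicit.
Unset Printing Implicit Defensive.
Import Order.TTheory GRing.Theory Num.Theory.
Import numFieldNormedType.Exports.
Local Open Scope classical_set_scope.
Local Open Scope ring_scope.

(* Functions on a subset C of R^n are total functions on 'rV[R]_n of which only
   the values on C matter; continuity on C is continuity for the subspace
   topology. The library norm on 'rV[R]_n is the sup norm, so the Euclidean norm
   is defined here; both induce the same topology and the same bounded sets. *)

Section Definitions.
Context {R : realType} {n : nat}.
Local Notation vec := 'rV[R]_n.
Implicit Types (C D K S : set vec) (f g h : vec -> R) (x u v : vec).

Definition dot u v : R := \sum_(i < n) u ord0 i * v ord0 i.

Definition enorm x : R := Num.sqrt (dot x x).

Definition is_cone C : Prop :=
  C !=set0 /\ forall (t : R) x, 0 < t -> C x -> C (t *: x).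

Definition asymptotic_cone S : set vec :=
  [set v | exists (t : nat -> R) (x : nat -> vec),
    [/\ t k @[k --> \oo] --> +oo,
        forall k, S (x k) &
        (t k)^-1 *: x k @[k --> \oo] --> v]].

Definition dual_cone D : set vec :=
  [set u | forall v, D v -> 0 <= dot u v].

Definition pos_homogeneous C (alpha : R) h : Prop :=
  forall (t : R) x, 0 < t -> C x -> h (t *: x) = t `^ alpha * h x.

Definition negligible_at_infinity K (alpha : R) g : Prop :=
  forall e : R, 0 < e ->
    \forall M \near +oo, forall x, K x -> M < enorm x ->
      `|g x / enorm x `^ alpha| < e.

Definition asymptotically_homogeneous C K (alpha : R) f h : Prop :=
  [/\ {within C, continuous h},
      pos_homogeneous C alpha h &
      negligible_at_infinity K alpha (fun x => f x - h x)].

Definition weakly_homogeneous C K (alpha : R) f : Prop :=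
  0 < alpha /\ exists h, asymptotically_homogeneous C K alpha f h.

Definition Sol S g : set vec :=
  [set x | S x /\ forall y, S y -> g x <= g y].

(* The asymptotically homogeneous function finf of f is an explicit argument,
   since it is determined only on the asymptotic cone of K. *)
Definition solution_kernel K (finf : vec -> R) : set vec := Sol (asymptotic_cone K) finf.

Definition perturb f u : vec -> R := fun x => f x + dot u x.

Definition solution_map K f : vec -> set vec := fun u => Sol K (perturb f u).

End Definitions.

Definition upper_semicontinuous_at {X Y : topologicalType} (Phi : X -> set Y)
    (x : X) : Prop :=
  forall V : set Y, open V -> Phi x `<=` V -> \forall x' \near x, Phi x' `<=` V.

Definition upper_semicontinuous_on {X Y : topologicalType} (Phi : X -> set Y)
    (T : set X) : Prop :=
  forall x, T x -> upper_semicontinuous_at Phi x.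

(* Main.v *)
Require Import Defs.
From mathcomp Require Import all_boot all_order all_algebra.
From mathcomp Require Import all_classical all_reals all_analysis.
From mathcomp Require Import lra.
Import Order.TTheory GRing.Theory Num.Theory.
Import numFieldNormedType.Exports.
Local Open Scope classical_set_scope.
Local Open Scope ring_scope.

(** If upper semicontinuity fails at [u0], there are [u_k --> u0] and minimizers
    [x_k] of [f + <u_k, .>] over [K] lying outside an open [V] that contains
    [Sol(K, f + <u0, .>)]. A cluster point of a bounded [x_k] minimizes
    [f + <u0, .>] and stays outside [V], a contradiction. If [|x_k| --> oo], let
    [v] be a limit of the directions [x_k / |x_k|]. Comparing the value at [x_k]
    with the one at a fixed point of [K] and dividing by [|x_k|^alpha], where
    [alpha > 1], gives [finf v <= 0]; as [f] is bounded below, [finf >= 0] on the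
    asymptotic cone, so [v] is a nonzero element of the kernel and [<u0, v> > 0].
    Dividing by [|x_k|] instead and using again that [f] is bounded below gives
    [<u0, v> <= 0]. *)

(** * Euclidean geometry of row vectors, subsequences and dual cones *)

Section EuclideanSpace.
Context {R : realType} {n : nat}.
Implicit Types (u v x y : 'rV[R]_n) (a t : R).

Lemma dotZl a u v : dot (a *: u) v = a * dot u v.
Proof. by rewrite /dot mulr_sumr; apply: eq_bigr => i _; rewrite mxE mulrA. Qed.

Lemma dotZr a u v : dot u (a *: v) = a * dot u v.
Proof. by rewrite /dot mulr_sumr; apply: eq_bigr => i _; rewrite mxE mulrCA. Qed.

Lemma dotBl u v x : dot (u - v) x = dot u x - dot v x.
Proof. by rewrite /dot -sumrB; apply: eq_bigr => i _; rewrite !mxE mulrBl. Qed.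

Lemma dot_ge0 x : 0 <= dot x x.
Proof. by apply: sumr_ge0 => i _; rewrite -expr2 sqr_ge0. Qed.

Lemma dot_gt0 x : x != 0 -> 0 < dot x x.
Proof.
move=> x0; rewrite lt_neqAle dot_ge0 andbT eq_sym; apply: contra x0 => /eqP.
move=> /psumr_eq0P x0; apply/eqP/rowP => i; rewrite mxE.
have /eqP := x0 (fun i _ => sqr_ge0 (x ord0 i)) i isT.
by rewrite mulf_eq0 orbb => /eqP.
Qed.

Lemma cvg_dot {T : Type} {F : set_system T} {FF : Filter F}
    (f g : T -> 'rV[R]_n) u v :
  f z @[z --> F] --> u -> g z @[z --> F] --> v ->
  dot (f z) (g z) @[z --> F] --> dot u v.
Proof.
move=> fu gv; rewrite /dot.
apply: (@cvg_big R _ +%R 0 xpredT (@add_continuous R)) => i _.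
have coord (h : T -> 'rV[R]_n) (w : 'rV[R]_n) : h z @[z --> F] --> w ->
    h z ord0 i @[z --> F] --> w ord0 i.
  exact: (continuous_cvg _ (@coord_continuous _ _ _ ord0 i w)).
by apply: cvgM; apply: coord.
Qed.

Lemma enorm_ge0 x : 0 <= enorm x.
Proof. exact: sqrtr_ge0. Qed.

Lemma enorm_gt0 x : (0 < enorm x) = (x != 0).
Proof.
rewrite sqrtr_gt0; apply/idP/idP => [|/dot_gt0//].
by apply: contraTneq => ->; rewrite -(scale0r x) dotZl mul0r ltxx.
Qed.

Lemma enormZ t x : 0 <= t -> enorm (t *: x) = t * enorm x.
Proof.
move=> t0; rewrite /enorm dotZl dotZr mulrA -expr2.
by rewrite sqrtrM ?sqr_ge0// sqrtr_sqr ger0_norm.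
Qed.

(** Turns Euclidean bounds into sup-norm bounds, the form in which compactness is available. *)
Lemma norm_le_enorm x : `|x| <= enorm x.
Proof.
rewrite [`|x|]mx_normrE; apply/bigmax_leP; split=> [|[i j] _]; first exact: enorm_ge0.
rewrite /= ord1 -sqrtr_sqr ler_sqrt ?dot_ge0// /dot (bigD1 j)//= -expr2.
by rewrite lerDl sumr_ge0// => k _; rewrite -expr2 sqr_ge0.
Qed.

Lemma cvg_enorm {T : Type} {F : set_system T} {FF : Filter F}
    (f : T -> 'rV[R]_n) v :
  f z @[z --> F] --> v -> enorm (f z) @[z --> F] --> enorm v.
Proof.
move=> fv; exact: (continuous_cvg _ (@sqrt_continuous R _) (cvg_dot _ _ _ _ fv fv)).
Qed.

(** Either some index beyond each [k] has norm above [k], and such indices are chosen, or a tail of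
    [x] stays in a compact ball and terms ever closer to a cluster point are chosen. The map [s]
    need not be monotone: its divergence is enough to compose limits. *)
Lemma subsequence_dichotomy (x : nat -> 'rV[R]_n) :
  exists2 s : nat -> nat, s k @[k --> \oo] --> \oo &
    enorm (x (s k)) @[k --> \oo] --> +oo \/
    exists v, x (s k) @[k --> \oo] --> v.
Proof.
have [xoo|] := pselect (forall k, exists j, (k <= j)%N /\ k%:R < enorm (x j)).
  have [s sP] := choice xoo; exists s.
    by apply/cvgnyPge => N; near=> k; apply: leq_trans (sP k).1; near: k; exists N.
  left; apply/cvgryPge => A.
  near=> k; apply: le_trans (ltW (sP k).2); near: k.
  exact: (cvgryPge _).1 cvgr_idn A.
move=> /existsNP[N /forallNP xN].
have ballc : compact [set y : 'rV[R]_n | `|y| <= N%:R].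
  apply: bounded_closed_compact.
    by exists N%:R; split => // M NM y /= /le_trans; apply; exact: ltW.
  rewrite (_ : mkset _ = Num.norm @^-1` [set r | r <= N%:R])//.
  by apply: closed_comp; [move=> ? _; exact: norm_continuous|exact: closed_le].
have [|v [_ clv]] := ballc (x k @[k --> \oo]) _.
  exists N => // k /= Nk; apply: le_trans (norm_le_enorm _) _.
  by rewrite leNgt; apply/negP => xk; apply: (xN k).
have xv k : exists j, (k <= j)%N /\ `|v - x j| < k.+1%:R^-1.
  have [||_ [[j /= kj <-] jv]] := clv (x @` [set j | (k <= j)%N]) (ball v k.+1%:R^-1).
  - by exists k => // j /= kj; exists j.
  - by apply: nbhsx_ballx; rewrite invr_gt0.
  by exists j; split=> //; move: jv; rewrite -ball_normE.
have [s sP] := choice xv; exists s.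
  by apply/cvgnyPge => M; near=> k; apply: leq_trans (sP k).1; near: k; exists M.
right; exists v; apply/cvgrPdist_lt => e e0.
near=> k; apply: lt_trans (sP k).2 _; near: k.
exact: (cvgr_lt _ cvg_harmonic).
Unshelve. all: by end_near. Qed.

(** For small [t > 0] the vector [u - t *: v] is still in the dual cone; pairing it with [v] gives
    [dot u v >= t * dot v v > 0]. *)
Lemma dual_cone_interior_gt0 (D : set 'rV[R]_n) u v :
  interior (dual_cone D) u -> D v -> v != 0 -> 0 < dot u v.
Proof.
move=> Du Dv v0.
have : \forall t \near (0:R)^'+, dual_cone D (u - t *: v).
  have cu : u - t *: v @[t --> (0:R)^'+] --> u - 0 *: v.
    apply: cvgB; first exact: cvg_cst.
    exact: (cvgZ (cvg_at_right_filter (@cvg_id _ (nbhs (0 : R)))) (cvg_cst v)).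
  by rewrite scale0r subr0 in cu; exact: cu _ Du.
move=> uD; near (0:R)^'+ => t.
have t0 : 0 < t by near: t; exact: nbhs_right_gt.
have /(_ v Dv) : dual_cone D (u - t *: v) by near: t.
rewrite dotBl dotZl subr_ge0; apply: lt_le_trans.
by rewrite mulr_gt0// dot_gt0.
Unshelve. all: by end_near. Qed.

End EuclideanSpace.

Lemma powR_cvgy_inv {R : realType} {T : Type} {F : set_system T}
    {FF : Filter F} (r : T -> R) (p : R) :
  0 < p -> r z @[z --> F] --> +oo -> (r z `^ p)^-1 @[z --> F] --> 0.
Proof.
move=> p0 roo.
have r0 : \forall z \near F, 0 < r z by exact: (cvgryPgt _).1 roo 0.
apply/gtr0_cvgV0; first by near=> z; rewrite powR_gt0//; near: z.
apply/cvgryPge => A; near=> z.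
(* The threshold is the [p]-th root of [|A|]; the absolute value keeps the base of the power
   nonnegative. *)
have rA : `|A| `^ p^-1 <= r z by near: z; exact: (cvgryPge _).1 roo _.
apply: le_trans (ler_norm A) _.
rewrite -(@powRr1 _ `|A|)// -(mulVf (lt0r_neq0 p0)) powRrM.
apply: ge0_ler_powR; rewrite ?nnegrE ?powR_ge0 ?(ltW p0)//.
exact: le_trans (powR_ge0 _ _) rA.
Unshelve. all: by end_near. Qed.


(** * Limits along sequences in [K] whose norms diverge *)

Section WeaklyHomogeneous.
Context {R : realType} {n : nat}.
Implicit Types (C K : set 'rV[R]_n) (f h : 'rV[R]_n -> R) (u v x : 'rV[R]_n).

Lemma cvg_within_closed {Y : topologicalType} C (g : 'rV[R]_n -> Y)
    (x : nat -> 'rV[R]_n) v :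
  closed C -> {within C, continuous g} -> (\forall k \near \oo, C (x k)) ->
  x k @[k --> \oo] --> v -> g (x k) @[k --> \oo] --> g v.
Proof.
move=> clC /subspace_continuousP gc Cx xv.
have Cv : C v by exact: (closed_cvg C clC Cx v xv).
move=> A gA; have vA := xv _ (gc v Cv _ gA).
change (\forall k \near \oo, A (g (x k))).
near=> k; suff : C (x k) -> A (g (x k)) by apply; near: k.
by near: k; exact: vA.
Unshelve. all: by end_near. Qed.

Lemma cvg_recession C K (alpha : R) f h (x : nat -> 'rV[R]_n) v :
  is_cone C -> closed C -> K `<=` C ->
  asymptotically_homogeneous C K alpha f h ->
  (\forall k \near \oo, K (x k)) ->
  enorm (x k) @[k --> \oo] --> +oo ->
  (enorm (x k))^-1 *: x k @[k --> \oo] --> v ->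
  C v /\ f (x k) / enorm (x k) `^ alpha @[k --> \oo] --> h v.
Proof.
move=> [_ coneC] clC KC [hc hh neg] Kx xoo xv.
have x0 : \forall k \near \oo, 0 < enorm (x k) by exact: (cvgryPgt _).1 xoo 0.
have Cx : \forall k \near \oo, C ((enorm (x k))^-1 *: x k).
  near=> k; apply: coneC; first by rewrite invr_gt0; near: k.
  by apply: KC; near: k.
split; first exact: (closed_cvg C clC Cx v xv).
have hv := cvg_within_closed _ _ _ _ clC hc Cx xv.
apply/cvgrPdist_lt => e e0.
have e2 : 0 < e / 2 by rewrite divr_gt0.
have [M [_ negM]] := neg _ e2.
near=> k.
have xk0 : 0 < enorm (x k) by near: k.
have Kk : K (x k) by near: k.
have H1 : `|h v - h ((enorm (x k))^-1 *: x k)| < e / 2.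
  by near: k; exact: (cvgrPdist_lt _ _).1 hv _ e2.
have H2 : `|(f (x k) - h (x k)) / enorm (x k) `^ alpha| < e / 2.
  (* The neighbourhood of [+oo] only covers bounds strictly above [M], hence [M + 1]. *)
  apply: (negM (M + 1)) => //; first by rewrite ltrDl.
  by near: k; exact: (cvgryPgt _).1 xoo _.
have E : h ((enorm (x k))^-1 *: x k) = h (x k) / enorm (x k) `^ alpha.
  have := hh (enorm (x k)) ((enorm (x k))^-1 *: x k) xk0.
  rewrite scalerA divff ?lt0r_neq0// scale1r => ->; last by near: k.
  by rewrite mulrAC divff ?mul1r// lt0r_neq0// powR_gt0.
rewrite E in H1; rewrite -normrN in H2.
rewrite [ltRHS]splitr; apply: le_lt_trans (ltrD H1 H2).
by apply: le_trans (ler_normD _ _); rewrite mulrBl opprB addrA subrK.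
Unshelve. all: by end_near. Qed.

Lemma asymptotic_cone_ge0 C K (alpha : R) f h v :
  is_cone C -> closed C -> K `<=` C -> 0 < alpha ->
  asymptotically_homogeneous C K alpha f h ->
  has_lbound (f @` K) -> asymptotic_cone K v -> 0 <= h v.
Proof.
move=> coneC clC KC alpha0 fh [c cP] [t [x [too Kx xv]]].
have [_ hh _] := fh.
have t0 : \forall k \near \oo, 0 < t k by exact: (cvgryPgt _).1 too 0.
have Cv : C v.
  apply: (closed_cvg C clC _ v xv).
  by near=> k; apply: coneC.2; [rewrite invr_gt0; near: k|exact: KC].
have [v0|v0] := eqVneq v 0.
  (* Homogeneity at [0] reads [h 0 = 2 `^ alpha * h 0]. *)
  have := hh 2 v (ltr0Sn R 1) Cv.
  rewrite v0 scaler0 => /eqP; rewrite -subr_eq0 -[X in X - _]mul1r -mulrBl.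
  rewrite mulf_eq0 subr_eq0 => /orP[/eqP two|/eqP-> //].
  have : (1 : R) `^ alpha < 2 `^ alpha.
    by apply: gt0_ltr_powR; rewrite ?nnegrE// ltr1n.
  by rewrite -two powR1 ltxx.
have ev0 : 0 < enorm v by rewrite enorm_gt0.
pose y k := (t k)^-1 *: x k.
have yv : enorm (y k) @[k --> \oo] --> enorm v by exact: cvg_enorm.
have xE k : 0 < t k -> enorm (x k) = t k * enorm (y k).
  by move=> tk; rewrite enormZ ?invr_ge0 ?ltW// mulVKf// lt0r_neq0.
have xoo : enorm (x k) @[k --> \oo] --> +oo.
  apply/cvgryPge => A; near=> k.
  have tk : 0 < t k by near: k.
  (* Since [enorm (x k) = t k * enorm (y k)] and eventually [enorm (y k) >= enorm v / 2], this bound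
     on [t k] forces [enorm (x k) >= |A|]. *)
  have tA : `|A| / (enorm v / 2) <= t k by near: k; exact: (cvgryPge _).1 too _.
  have yk : enorm v / 2 <= enorm (y k).
    near: k; apply: (cvgr_ge _ yv).
    by rewrite ltr_pdivrMr// ltr_pMr// ltr1n.
  rewrite xE//; apply: le_trans (ler_norm A) _.
  rewrite ler_pdivrMr ?divr_gt0// in tA; apply: le_trans tA _.
  by rewrite ler_wpM2l// ltW.
have xw : (enorm (x k))^-1 *: x k @[k --> \oo] --> (enorm v)^-1 *: v.
  have yw : (enorm (y k))^-1 *: y k @[k --> \oo] --> (enorm v)^-1 *: v.
    by apply: cvgZ => //; apply: cvgV => //; rewrite lt0r_neq0.
  apply: cvg_trans yw; apply: near_eq_cvg; near=> k.
  have tk : 0 < t k by near: k.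
  by rewrite xE// /y scalerA -invfM mulrC.
have Kx' : \forall k \near \oo, K (x k) by near=> k.
have [Cw fw] := cvg_recession _ _ _ _ _ _ _ coneC clC KC fh Kx' xoo xw.
have hw : 0 <= h ((enorm v)^-1 *: v).
  have c0 : c * (enorm (x k) `^ alpha)^-1 @[k --> \oo] --> c * 0.
    by apply: cvgM; [exact: cvg_cst|exact: powR_cvgy_inv].
  rewrite mulr0 in c0; apply: (ler_cvg_to c0 fw); near=> k.
  by rewrite ler_wpM2r ?invr_ge0 ?powR_ge0//; apply: cP; exists (x k).
rewrite (_ : v = enorm v *: ((enorm v)^-1 *: v)).
  by rewrite hh// mulr_ge0// powR_ge0.
by rewrite scalerA divff ?scale1r// lt0r_neq0.
Unshelve. all: by end_near. Qed.

Lemma minimizers_do_not_escape C K (alpha : R) f h (u x : nat -> 'rV[R]_n) u0 :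
  is_cone C -> closed C -> K `<=` C -> 1 < alpha ->
  asymptotically_homogeneous C K alpha f h ->
  has_lbound (f @` K) ->
  interior (dual_cone (solution_kernel K h)) u0 ->
  u k @[k --> \oo] --> u0 -> (forall k, solution_map K f (u k) (x k)) ->
  ~ (enorm (x k) @[k --> \oo] --> +oo).
Proof.
move=> coneC clC KC alpha1 fh lbf Du0 uu0 Sx xoo.
have Kx k : K (x k) by have [] := Sx k.
have x0 : \forall k \near \oo, 0 < enorm (x k) by exact: (cvgryPgt _).1 xoo 0.
have [s soo [yoo|[v yv]]] :=
  subsequence_dichotomy (fun k => (enorm (x k))^-1 *: x k).
  (* The directions have norm [1], so the divergent alternative is absurd. *)
  have : \forall k \near \oo, 1 < enorm ((enorm (x (s k)))^-1 *: x (s k)).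
    exact: (cvgryPgt _).1 yoo 1.
  move=> y1; near \oo => k.
  have : 1 < enorm ((enorm (x (s k)))^-1 *: x (s k)) by near: k.
  have xs : 0 < enorm (x (s k)) by near: k; exact: soo _ x0.
  by rewrite enormZ ?invr_ge0 ?enorm_ge0// mulVf ?ltxx// lt0r_neq0.
have xsoo : enorm (x (s k)) @[k --> \oo] --> +oo by exact: (cvg_comp _ _ soo xoo).
have usu0 : u (s k) @[k --> \oo] --> u0 by exact: (cvg_comp _ _ soo uu0).
have xs0 : \forall k \near \oo, 0 < enorm (x (s k)) by exact: soo _ x0.
have Kxs : \forall k \near \oo, K (x (s k)) by near=> k.
have [Cv fv] := cvg_recession _ _ _ _ _ (fun k => x (s k)) _ coneC clC KC fh
  Kxs xsoo yv.
have v0 : v != 0.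
  rewrite -enorm_gt0; apply: lt_le_trans ltr01 _.
  apply: (cvgr_to_ge (cvg_enorm _ _ yv)); near=> k.
  have xs : 0 < enorm (x (s k)) by near: k.
  by rewrite enormZ ?invr_ge0 ?enorm_ge0// mulVf// lt0r_neq0.
have Kv : asymptotic_cone K v.
  by exists (fun k => enorm (x (s k))), (fun k => x (s k)).
have [c cP] := lbf.
(* The first term [x 0] serves as the fixed competitor in [K]. *)
have Sle k : f (x (s k)) + dot (u (s k)) (x (s k)) <=
    f (x 0) + dot (u (s k)) (x 0) by exact: (Sx (s k)).2.
have rhs : f (x 0) + dot (u (s k)) (x 0) @[k --> \oo] --> f (x 0) + dot u0 (x 0).
  by apply: cvgD; [exact: cvg_cst|apply: cvg_dot => //; exact: cvg_cst].
have uv : dot (u (s k)) ((enorm (x (s k)))^-1 *: x (s k)) @[k --> \oo]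
    --> dot u0 v by exact: cvg_dot.
have hv_le0 : h v <= 0.
  (* [Sle] divided by [enorm (x (s k)) `^ alpha] *)
  have Plim : (f (x 0) + dot (u (s k)) (x 0)) * (enorm (x (s k)) `^ alpha)^-1
      - dot (u (s k)) ((enorm (x (s k)))^-1 *: x (s k)) *
        (enorm (x (s k)) `^ (alpha - 1))^-1 @[k --> \oo]
      --> (f (x 0) + dot u0 (x 0)) * 0 - dot u0 v * 0.
    (* The linear term at [x (s k)] keeps one power of the norm to normalize its argument, leaving
       the exponent [alpha - 1], positive because [1 < alpha]. *)
    by apply: cvgB; apply: cvgM => //; apply: powR_cvgy_inv => //; lra.
  rewrite !mulr0 subr0 in Plim; apply: (ler_cvg_to fv Plim); near=> k.
  have xs : 0 < enorm (x (s k)) by near: k.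
  rewrite dotZr (mulrC _^-1) -mulrA -invfM mulr_powRB1 ?(ltW xs)//; last by lra.
  rewrite -mulrBl ler_wpM2r ?invr_ge0 ?powR_ge0//.
  by rewrite lerBrDr.
have ker : solution_kernel K h v.
  (* Every value of [h] on the asymptotic cone is at least [0 >= h v]. *)
  split=> // w Kw; apply: le_trans hv_le0 _.
  by apply: (asymptotic_cone_ge0 _ _ _ _ _ _ coneC clC KC _ fh lbf Kw); lra.
have := dual_cone_interior_gt0 _ _ _ Du0 ker v0; apply/negP; rewrite -leNgt.
(* [Sle], with [f (x (s k))] replaced by its lower bound [c], divided by
   [enorm (x (s k))] *)
have Qlim : (f (x 0) + dot (u (s k)) (x 0) - c) * (enorm (x (s k)))^-1
    @[k --> \oo] --> (f (x 0) + dot u0 (x 0) - c) * 0.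
  apply: cvgM; first by apply: cvgB => //; exact: cvg_cst.
  by apply/gtr0_cvgV0.
rewrite mulr0 in Qlim; apply: (ler_cvg_to uv Qlim); near=> k.
have xs : 0 < enorm (x (s k)) by near: k.
rewrite dotZr mulrC ler_wpM2r ?invr_ge0 ?enorm_ge0// lerBrDl.
by apply: le_trans (Sle k); rewrite lerD2r; apply: cP; exists (x (s k)).
Unshelve. all: by end_near. Qed.

End WeaklyHomogeneous.

(** * Upper semicontinuity of the solution map *)

Theorem theorem6p1 (R : realType) (n : nat) (C K : set 'rV[R]_n)
    (f : 'rV[R]_n -> R) (alpha : R)
    (coneC : is_cone C) (closedC : closed C)
    (KC : K `<=` C) (K0 : K !=set0) (closedK : closed K)
    (unboundedK : ~ bounded_set K)
    (contf : {within C, continuous f})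
    (alpha1 : 1 < alpha)
    (whf : weakly_homogeneous C K alpha f)
    (lbf : has_lbound (f @` K)) :
  forall finf : 'rV[R]_n -> R,
    asymptotically_homogeneous C K alpha f finf ->
    upper_semicontinuous_on (solution_map K f)
      (interior (dual_cone (solution_kernel K finf))).
Proof.
move=> finf fh u0 Du0 V openV SV; apply: contrapT => nSV.
(* Failure of semicontinuity on the ball of radius [1 / (k + 1)] around [u0] yields a parameter
   [p.1] and a minimizer [p.2] outside [V]. *)
have bad k : exists p : 'rV[R]_n * 'rV[R]_n,
    [/\ `|u0 - p.1| < k.+1%:R^-1, solution_map K f p.1 p.2 & ~ V p.2].
  apply: contrapT => /forallNP good; apply: nSV.
  have : \forall u \near u0, ball u0 (k.+1%:R^-1 : R) u.
    by apply: near_ball; rewrite invr_gt0.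
  apply: filterS => u; rewrite -ball_normE /= => uu0 x Sx.
  by apply: contrapT => nVx; apply: (good (u, x)).
have [p pP] := choice bad.
have pu0 : (p k).1 @[k --> \oo] --> u0.
  apply/cvgrPdist_lt => e e0; near=> k.
  have [pk _ _] := pP k; apply: lt_trans pk _; near: k.
  exact: (cvgr_lt _ cvg_harmonic).
have [s soo] := subsequence_dichotomy (fun k => (p k).2).
have us : (p (s k)).1 @[k --> \oo] --> u0 by exact: (cvg_comp _ _ soo pu0).
have Ss k : solution_map K f (p (s k)).1 (p (s k)).2 by have [] := pP (s k).
case=> [|[z xz]].
  exact: (minimizers_do_not_escape _ _ _ _ _ _ _ _ coneC closedC KC alpha1 fh
    lbf Du0 us Ss).
have Ks k : K (p (s k)).2 by have [] := Ss k.
have Kz : K z by apply: (closed_cvg K closedK _ z xz); near=> k.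
have nVz : ~ V z.
  apply: (closed_cvg (~` V) (open_closedC openV) _ z xz).
  by near=> k; have [] := pP (s k).
(* It remains to see that [z] minimizes for [u0]: for each fixed competitor [y], the minimality
   inequality passes to the limit. *)
apply: nVz; apply: SV; split=> // y Ky.
have fz : f (p (s k)).2 @[k --> \oo] --> f z.
  by apply: (cvg_within_closed _ _ _ _ closedC contf _ xz); near=> k; apply: KC.
have lhs : perturb f (p (s k)).1 (p (s k)).2 @[k --> \oo] --> perturb f u0 z.
  by apply: cvgD => //; exact: cvg_dot.
have rhs : perturb f (p (s k)).1 y @[k --> \oo] --> perturb f u0 y.
  by apply: cvgD; [exact: cvg_cst|apply: cvg_dot => //; exact: cvg_cst].
by apply: (ler_cvg_to lhs rhs); near=> k; exact: (Ss k).2.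
Unshelve. all: by end_near. Qed.
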